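(* Let $A$ be an alternative Cartan $*$-algebra with $\mathbb{S}_A\ne\varnothing$, let $\Omega\subset Q_A$ be a circular slice domain, let $\mathcal{C}$ be a system of Cartan pairs (SCP) of $A$, and let $f,g:\Omega\to A$ be slice regular functions with real components $f_K,g_K$ ($K\in\mathcal{P}(n)$). If $f_L=g_L$ on $\Omega\cap\mathbb{C}_{e_{L\triangle M}}$ for each $L,M\in\mathcal{P}(n)$ such that $(e_L,e_M)\in\mathcal{C}$, then $f$ and $g$ coincide on $\Omega$ up to an additive constant (that is, $f-g$ is constant on $\Omega$).
   Context: **Cartan $*$-algebras.** Let $n\ge 1$, let $\mathcal{P}(n)$ be the power set of $\{1,\dots,n\}$ and $K\triangle H:=(K\setminus H)\cup(H\setminus K)$. A Cartan algebra is a real (not necessarily associative) algebra $A$ with a fixed real vector basis $\{e_K\}_{K\in\mathcal{P}(n)}$ and a function $\sigma:\mathcal{P}(n)\times\mathcal{P}(n)\to\{-1,1\}$ such that $\sigma(K,\varnothing)=\sigma(\varnothing,K)=1$ and $e_Ke_H=\sigma(K,H)e_{K\triangle H}$ for all $K,H$. Thus $e_\varnothing=1$ is the unity, and $\mathbb{R}$ is identified with $\mathbb{R}1\subset A$. $A$ is alternative if $x(xy)=x^2y$ and $(xy)y=xy^2$ for all $x,y$. A $*$-involution is a real linear map $x\mapsto x^c$ with $(x^c)^c=x$, $(xy)^c=y^cx^c$ and $x^c=x$ for $x\in\mathbb{R}$. A Cartan $*$-algebra is a Cartan algebra endowed with a $*$-involution such that $e_{\{k\}}^c\in\{e_{\{k\}},-e_{\{k\}}\}$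 for $k=1,\dots,n$. Set $\mathbb{S}_A:=\{J\in A: J^c=-J,\ J^2=-1\}$. The paper assumes throughout that $A$ is alternative and $\mathbb{S}_A\neq\varnothing$. **Systems of Cartan pairs.** For $L,M\in\mathcal{P}(n)$, $(e_L,e_M)$ is a Cartan pair if $e_Le_M\in\mathbb{S}_A$ (equivalently $e_{L\triangle M}\in\mathbb{S}_A$). For a set $\mathcal{C}$ of pairs $(e_L,e_M)$, put $\mathcal{C}_1:=\{L:\exists M,\ (e_L,e_M)\in\mathcal{C}\}$ and $\mathcal{C}_2:=\{M:\exists L,\ (e_L,e_M)\in\mathcal{C}\}$. $\mathcal{C}$ is a system of Cartan pairs (SCP) of $A$ if all its elements are Cartan pairs, $\mathcal{C}_1\cup\mathcal{C}_2=\mathcal{P}(n)$ and $\mathcal{C}_1\cap\mathcal{C}_2=\varnothing$. **Slice regular functions.** For $J\in\mathbb{S}_A$ let $\mathbb{C}_J:=\{\alpha+\beta J:\alpha,\beta\in\mathbb{R}\}$, and let $Q_A:=\bigcup_{J\in\mathbb{S}_A}\mathbb{C}_J$. For $D\subset\mathbb{C}$ non-empty, open and invariant under complex conjugation, let $\Omega_D:=\{\alpha+\beta J:\alpha,\beta\in\mathbb{R},\ \alpha+i\beta\in D,\ J\in\mathbb{S}_A\}\subset Q_A$ (an open circular set). It is a circular slice domain if moreover $D$ is connected and $D\cap\mathbb{R}\ne\varnothing$. A stem function on $D$ is $F=F_1+\iota F_2:D\to A\otimes_{\mathbb{R}}\mathbb{C}$ ($\iota$ the imaginary unit of the second factor,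 $F_1,F_2:D\to A$) with $F_1(\bar z)=F_1(z)$, $F_2(\bar z)=-F_2(z)$. It induces the slice function $f=\mathcal{I}(F):\Omega_D\to A$, $f(\alpha+\beta J)=F_1(\alpha+i\beta)+JF_2(\alpha+i\beta)$. $f$ is slice regular if $F$ is of class $C^1$ and $\frac{\partial F}{\partial\alpha}+\iota\frac{\partial F}{\partial\beta}=0$. The real components of $f$ are the functions $f_K:\Omega_D\to\mathbb{R}$ with $f=\sum_K f_Ke_K$. *)

(* Defs.v *)
From mathcomp Require Import all_boot all_order all_algebra.
From mathcomp Require Import all_classical all_reals all_analysis.

Set Implicit Arguments.
Unset Strict Implicit.
Unset Printing Implicit Defensive.

Import Order.TTheory GRing.Theory Num.Theory.
Import numFieldNormedType.Exports.
Local Open Scope ring_scope.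

Definition symdiff (T : finType) (K H : {set T}) : {set T} :=
  (K :\: H) :|: (H :\: K).

(* [basis_of] and [coord] work with tuples, so a family indexed by subsets is
   listed along the enumeration of [{set 'I_n}]. *)
Definition subset_tuple (n : nat) (T : Type) (e : {set 'I_n} -> T) :
    #|{set 'I_n}|.-tuple T :=
  [tuple e (enum_val i) | i < #|{set 'I_n}|].

(* The index set {1, ..., n} is represented by ['I_n]. The product is a plain
   bilinear operation, since it need not be associative. *)
Record cartanAlgebra (R : realType) (n : nat) := CartanAlgebra {
  ca_sort :> vectType R;
  ca_mul : ca_sort -> ca_sort -> ca_sort;
  ca_mul_linearr : forall x, linear (ca_mul x);
  ca_mul_linearl : forall y, linear (ca_mul^~ y);
  ca_e : {set 'I_n} -> ca_sort;
  ca_e_basis : basis_of fullv (subset_tuple ca_e);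
  ca_sigma : {set 'I_n} -> {set 'I_n} -> R;
  ca_sigma_sign : forall K H, ca_sigma K H = -1 \/ ca_sigma K H = 1;
  ca_sigma0r : forall K, ca_sigma K finset.set0 = 1;
  ca_sigma0l : forall K, ca_sigma finset.set0 K = 1;
  ca_mul_e : forall K H,
    ca_mul (ca_e K) (ca_e H) = ca_sigma K H *: ca_e (symdiff K H)
}.

Definition ca_one (R : realType) (n : nat) (A : cartanAlgebra R n) : A :=
  ca_e A finset.set0.

Record cartanStarAlgebra (R : realType) (n : nat) := CartanStarAlgebra {
  csa_alg :> cartanAlgebra R n;
  csa_conj : csa_alg -> csa_alg;
  csa_conj_linear : linear csa_conj;
  csa_conjK : forall x, csa_conj (csa_conj x) = x;
  csa_conjM : forall x y,
    csa_conj (ca_mul x y) = ca_mul (csa_conj y) (csa_conj x);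
  csa_conj_real : forall a : R,
    csa_conj (a *: ca_one csa_alg) = a *: ca_one csa_alg;
  csa_conj_e1 : forall k : 'I_n,
    csa_conj (ca_e csa_alg [set k]%SET) = ca_e csa_alg [set k]%SET \/
    csa_conj (ca_e csa_alg [set k]%SET) = - ca_e csa_alg [set k]%SET
}.

Section CartanStarAlgebra.
Variables (R : realType) (n : nat) (A : cartanStarAlgebra R n).
Implicit Types (x y J : A) (K L M : {set 'I_n}) (D : set (R * R)).

Local Notation e := (ca_e A).
Local Notation "1A" := (ca_one A).
Local Notation "x '*A' y" := (ca_mul x y) (at level 40, left associativity).

Definition alternative : Prop :=
  (forall x y, x *A (x *A y) = (x *A x) *A y) /\
  (forall x y, (x *A y) *A y = x *A (y *A y)).

Definition component (K : {set 'I_n}) (x : A) : R :=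
  coord (subset_tuple e) (enum_rank K) x.

Definition imag_units : set A :=
  [set J | csa_conj J = - J /\ J *A J = - 1A]%classic.

Definition slice (J : A) : set A :=
  [set x | exists a b : R, x = a *: 1A + b *: J]%classic.

Definition quadratic_cone : set A :=
  (\bigcup_(J in imag_units) slice J)%classic.

Definition cartan_pair (L M : {set 'I_n}) : Prop := imag_units (e L *A e M).

Definition pair_fst (C : set (A * A)) : set {set 'I_n} :=
  [set L | exists M, C (e L, e M)]%classic.

Definition pair_snd (C : set (A * A)) : set {set 'I_n} :=
  [set M | exists L, C (e L, e M)]%classic.

Definition is_SCP (C : set (A * A)) : Prop :=
  [/\ forall p, C p -> exists L M, p = (e L, e M) /\ cartan_pair L M,
      (pair_fst C `|` pair_snd C)%classic = setT &
      (pair_fst C `&` pair_snd C)%classic = classical_sets.set0].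

(* The complex number a + i b is represented by the pair (a, b). *)

Definition stem_domain D : Prop :=
  [/\ (D !=set0)%classic, open D & forall a b, D (a, b) -> D (a, - b)].

Definition circularization D : set A :=
  [set x | exists a b J,
     [/\ D (a, b), imag_units J & x = a *: 1A + b *: J]]%classic.

Definition circular_slice_domain (Om : set A) : Prop :=
  exists D, [/\ stem_domain D, connected D, exists a, D (a, 0) &
                Om = circularization D].

Lemma circularization_sub D : (circularization D `<=` quadratic_cone)%classic.
Proof.
by move=> x [a [b [J [_ SJ ->]]]]; exists J => //; exists a, b.
Qed.

(* The complexification of A is represented by A * A, the pair (x, y) standing
   for x + iota y. *)
Definition iota_mul (w : A * A) : A * A := (- w.2, w.1).

Definition is_stem D (F : R * R -> A * A) : Prop :=
  forall a b, D (a, b) ->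
    (F (a, - b)).1 = (F (a, b)).1 /\ (F (a, - b)).2 = - (F (a, b)).2.

Definition dir_alpha : R * R := (1, 0).
Definition dir_beta : R * R := (0, 1).

(* [A] is finite dimensional, so differentiability of an A-valued map and its
   derivatives are taken component by component. *)
Definition C1_on D (G : R * R -> A) : Prop :=
  forall K v z, v = dir_alpha \/ v = dir_beta -> D z ->
    derivable (fun w => component K (G w)) z v /\
    {for z, continuous (fun w => 'D_v (fun w' => component K (G w')) w)}.

Definition partial (v : R * R) (G : R * R -> A) (z : R * R) : A :=
  \sum_K ('D_v (fun w => component K (G w)) z) *: e K.

Definition cpartial (v : R * R) (F : R * R -> A * A) (z : R * R) : A * A :=
  (partial v (fun w => (F w).1) z, partial v (fun w => (F w).2) z).

Definition holomorphic_stem D (F : R * R -> A * A) : Prop :=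
  [/\ is_stem D F,
      C1_on D (fun z => (F z).1), C1_on D (fun z => (F z).2) &
      forall z, D z ->
        cpartial dir_alpha F z + iota_mul (cpartial dir_beta F z) = 0].

(* Functions on a subset of A are total functions [A -> A] of which only the
   values on that subset matter. *)
Definition induced_on D (F : R * R -> A * A) (f : A -> A) : Prop :=
  forall a b J, D (a, b) -> imag_units J ->
    f (a *: 1A + b *: J) = (F (a, b)).1 + J *A (F (a, b)).2.

Definition slice_regular (Om : set A) (f : A -> A) : Prop :=
  exists D F, [/\ stem_domain D, Om = circularization D,
                  holomorphic_stem D F & induced_on D F f].

End CartanStarAlgebra.

Arguments imag_units {R n} A.
Arguments quadratic_cone {R n} A.

(* Main.v *)
Require Import Defs.
From mathcomp Require Import all_boot all_order all_algebra.
From mathcomp Require Import all_classical all_reals all_analysis.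

Import GRing.Theory numFieldNormedType.Exports.
Local Open Scope ring_scope.
Import Order.TTheory Num.Theory.

(** Write f and g as induced by stem functions F and G on the same D, and put
    Phi = F - G.  Fix a pair (e_L, e_M) of the system and J = e_(L sd M), where sd
    is the symmetric difference.  Since J e_K = +/- e_(L sd M sd K), the component
    of J y along e_L is +/- y_M.  Hence the hypothesis at alpha + beta J says
    (Phi_1)_L +/- (Phi_2)_M = 0 at z = alpha + i beta.  The hypothesis at
    alpha - beta J is the same relation at the conjugate of z, where Phi_2 changes
    sign.  Adding and subtracting, (Phi_1)_L = 0 and (Phi_2)_M = 0 on all of D
    ([component_stem_eq]).

    Each index K occurs as some L or as some M, so for every K one of the two
    real functions (Phi_1)_K, (Phi_2)_K vanishes.  They satisfy the
    Cauchy-Riemann equations on the connected open set D, so the other one is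
    constant ([cauchy_riemann_cst]).  Finally Phi_2 is odd in beta, hence zero at
    a real point of D, so a constant (Phi_2)_K is zero.  Thus Phi_2 = 0 and Phi_1
    is a constant, which is the value of f - g.

    Regularity of f and g is witnessed by domains that are not a priori the same;
    they agree because a circular set determines its conjugation-invariant planar
    domain ([circularization_inj]). *)

(** * Functions with vanishing partial derivatives *)

Section LocallyConstant.
Local Open Scope classical_set_scope.
Context {R : realType}.

Lemma is_derive_line (V W : normedModType R) (u : V -> W) (z v : V) (t : R) (l : W) :
  is_derive (z + t *: v) v u l ->
  is_derive t (1 : R) (fun s => u (z + s *: v)) l.
Proof.
move=> [ud ul].
have E : (fun h : R => h^-1 *: (((fun s => u (z + s *: v)) \o shift t) (h *: 1)
             - u (z + t *: v)))
    = (fun h => h^-1 *: ((u \o shift (z + t *: v)) (h *: v) - u (z + t *: v))).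
  apply/funext => h; congr (_ *: (u _ - _)) => /=.
  by rewrite -[h *: 1]/(h * 1) mulr1 scalerDl addrCA.
by split; [rewrite /derivable E | rewrite /derive E].
Qed.

(** The increment s may have either sign, so that both orientations of a segment
    are covered at once. *)
Lemma derive0_segment_cst (V : normedModType R) (u : V -> R) (z v : V) (s : R) :
  (forall t : R, `|t| <= `|s| -> is_derive (z + t *: v) v u 0) ->
  u (z + s *: v) = u z.
Proof.
move=> u0; pose phi (t : R) := u (z + t *: v).
have cst (a b : R) : a <= b ->
    (forall t, a <= t <= b -> is_derive t (1 : R) phi 0) -> phi a = phi b.
  move=> ab dphi; apply/esym/eqP; rewrite -subr_eq0; apply/eqP.
  have [t||c _ ->] := @MVT_segment R phi (fun=> 0) a b ab; last by rewrite mul0r.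
    by rewrite in_itv /= => /andP[at_ tb]; apply: dphi; rewrite !ltW.
  apply: derivable_within_continuous => t; rewrite in_itv /= => tab.
  by case: (dphi t tab).
rewrite -[in RHS](addr0 z) -[in RHS](scale0r v) -/(phi s) -/(phi 0).
have [s0|/ltW s0] := leP 0 s.
  apply/esym/cst => // t /andP[t0 ts]; apply/is_derive_line/u0.
  by rewrite !ger0_norm.
apply: cst => // t /andP[st t0]; apply/is_derive_line/u0.
by rewrite !ler0_norm // lerN2.
Qed.

(** Local constancy makes any set {u = c}, and also its complement in D, open; so
    {u = u z} is open and closed in D. *)
Lemma connected_locally_cst (T : topologicalType) (U : Type) (D : set T) (u : T -> U) :
  open D -> connected D ->
  (forall z, D z -> \forall w \near z, u w = u z) ->
  forall z w, D z -> D w -> u z = u w.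
Proof.
move=> Do Dc lc z w Dz Dw.
have openS (P : set U) : open [set x | D x /\ P (u x)].
  rewrite openE => x [Dx Px].
  near=> y; split; first by near: y; exact: open_nbhs_nbhs.
  by suff -> : u y = u x by []; near: y; exact: lc.
suff /seteqP[_ /(_ w Dw)[_ ->]] : [set x | D x /\ u x = u z] = D by [].
apply: Dc; first by exists z.
  exists [set x | D x /\ u x = u z]; first exact: (openS [set y | y = u z]).
  by apply/seteqP; split=> x /=; [case | case].
exists (~` [set x | D x /\ u x <> u z]).
  exact/open_closedC/(openS [set y | y <> u z]).
apply/seteqP; split=> x /=.
  by case=> Dx xz; split=> // -[].
by case=> Dx /not_andP[//|/contrapT].
Unshelve. all: by end_near.
Qed.

(** In a ball for the product distance, which is a square, any point is reached
    from the centre by a horizontal segment followed by a vertical one, and u is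
    constant along both. *)
Lemma derive0_connected_cst (D : set (R * R)) (u : R * R -> R) :
  open D -> connected D ->
  (forall z, D z -> is_derive z (dir_alpha R) u 0 /\ is_derive z (dir_beta R) u 0) ->
  forall z w, D z -> D w -> u z = u w.
Proof.
move=> Do Dc du; apply: connected_locally_cst => // -[a b] Dz.
have /nbhs_ballP[r /= r0 rD] : nbhs (a, b) D by exact: open_nbhs_nbhs.
apply/nbhs_ballP; exists r => // -[c d] [/= ac bd].
have E1 (t : R) : (a, b) + t *: dir_alpha R = (a + t, b).
  by congr pair; [rewrite /= -[t *: 1]/(t * 1) mulr1
                 |rewrite /= -[t *: 0]/(t * 0) mulr0 addr0].
have E2 (t : R) : (c, b) + t *: dir_beta R = (c, b + t).
  by congr pair; [rewrite /= -[t *: 0]/(t * 0) mulr0 addr0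
                 |rewrite /= -[t *: 1]/(t * 1) mulr1].
have near_in (x t y : R) : ball x r y -> `|t| <= `|y - x| -> ball x r (x + t).
  rewrite /ball /= => xy txy.
  by rewrite opprD addNKr normrN (le_lt_trans txy) // distrC.
transitivity (u (c, b)).
  have := @derive0_segment_cst _ u (c, b) (dir_beta R) (d - b).
  rewrite E2 (addrC b) subrK; apply => t td; rewrite E2.
  by case: (du (c, b + t)) => //; apply: rD; split=> //=; exact: near_in bd td.
have := @derive0_segment_cst _ u (a, b) (dir_alpha R) (c - a).
rewrite E1 (addrC a) subrK; apply => t tc; rewrite E1.
case: (du (a + t, b)) => //; apply: rD; split=> /=; first exact: near_in ac tc.
exact: ballxx.
Qed.

End LocallyConstant.

(** * The Cauchy-Riemann equations *)

Section CauchyRiemann.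
Local Open Scope classical_set_scope.
Context {R : realType}.
Implicit Types (D : set (R * R)) (u v : R * R -> R).

Definition cauchy_riemann D u v : Prop := forall z, D z ->
  [/\ forall d, d = dir_alpha R \/ d = dir_beta R -> derivable u z d /\ derivable v z d,
      'D_(dir_alpha R) u z = 'D_(dir_beta R) v z &
      'D_(dir_alpha R) v z = - 'D_(dir_beta R) u z].

Lemma cauchy_riemannB D u v u' v' :
  cauchy_riemann D u v -> cauchy_riemann D u' v' ->
  cauchy_riemann D (u - u') (v - v').
Proof.
move=> uv uv' z Dz; have [d1 e1 e2] := uv z Dz; have [d1' e1' e2'] := uv' z Dz.
have [[ua va] [ub vb]] := (d1 _ (or_introl erefl), d1 _ (or_intror erefl)).
have [[ua' va'] [ub' vb']] := (d1' _ (or_introl erefl), d1' _ (or_intror erefl)).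
split; first by move=> d dab; have [? ?] := d1 d dab; have [? ?] := d1' d dab;
  split; apply: derivableB.
  by rewrite !deriveB // e1 e1'.
by rewrite !deriveB // e2 e2' opprD.
Qed.

(** Multiplying u + i v by - i gives v - i u; this exchanges the roles of the real
    and imaginary parts in [cauchy_riemann_cst]. *)
Lemma cauchy_riemann_rot {D u v} : cauchy_riemann D u v -> cauchy_riemann D v (- u).
Proof.
move=> uv z Dz; have [d1 e1 e2] := uv z Dz.
have [[ua va] [ub vb]] := (d1 _ (or_introl erefl), d1 _ (or_intror erefl)).
split; first by move=> d /d1[ud vd]; split; [exact: vd | apply: derivableN ud].
  by rewrite (deriveN ub).
by rewrite (deriveN ua) e1.
Qed.

Lemma cauchy_riemann_cst {D u v} : open D -> connected D ->
  cauchy_riemann D u v -> (forall z, D z -> u z = 0) ->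
  forall z w, D z -> D w -> v z = v w.
Proof.
move=> Do Dc uv u0; apply: derive0_connected_cst => // z Dz.
have du0 d : 'D_d u z = 0.
  rewrite (@near_eq_derive _ _ _ u (cst 0)) ?derive_cst //.
  by near=> w; apply: u0; near: w; exact: open_nbhs_nbhs.
have [d1 e1 e2] := uv z Dz.
have [[_ va] [_ vb]] := (d1 _ (or_introl erefl), d1 _ (or_intror erefl)).
split; split=> //; first by rewrite e2 du0 oppr0.
by rewrite -e1 du0.
Unshelve. all: by end_near.
Qed.

End CauchyRiemann.

(** * Products and components in a Cartan algebra *)

Section Cartan.
Context {R : realType} {n : nat}.
Implicit Type A : cartanAlgebra R n.

Lemma nth_subset_tuple {A} (K : {set 'I_n}) :
  (subset_tuple (ca_e A))`_(enum_rank K) = ca_e A K.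
Proof. by rewrite -tnth_nth tnth_mktuple enum_rankK. Qed.

Lemma ca_mulrD {A} (x y z : A) : ca_mul x (y + z) = ca_mul x y + ca_mul x z.
Proof. by have := ca_mul_linearr x 1 y z; rewrite !scale1r. Qed.
Lemma ca_mulr0 {A} (x : A) : ca_mul x 0 = 0.
Proof. by apply: (addIr (ca_mul x 0)); rewrite -ca_mulrD !add0r. Qed.
Lemma ca_mulrZ {A} (x y : A) a : ca_mul x (a *: y) = a *: ca_mul x y.
Proof. by have := ca_mul_linearr x a y 0; rewrite !addr0 ca_mulr0 addr0. Qed.
Lemma ca_mullD {A} (x y z : A) : ca_mul (y + z) x = ca_mul y x + ca_mul z x.
Proof. by have := ca_mul_linearl x 1 y z; rewrite !scale1r. Qed.
Lemma ca_mull0 {A} (x : A) : ca_mul 0 x = 0.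
Proof. by apply: (addIr (ca_mul 0 x)); rewrite -ca_mullD !add0r. Qed.
Lemma ca_mullZ {A} (x y : A) a : ca_mul (a *: x) y = a *: ca_mul x y.
Proof. by have := ca_mul_linearl y a x 0; rewrite !addr0 ca_mull0 addr0. Qed.
Lemma ca_mulr_sum {A} (x : A) (F : {set 'I_n} -> A) :
  ca_mul x (\sum_K F K) = \sum_K ca_mul x (F K).
Proof.
by elim/big_rec2: _ => [|K y z _ <-]; rewrite ?ca_mulr0 // ca_mulrD.
Qed.

Lemma ca_sigma_neq0 A K H : ca_sigma A K H != 0.
Proof. by case: (ca_sigma_sign A K H) => ->; rewrite ?oppr_eq0 oner_eq0. Qed.

End Cartan.

Section Component.
Context {R : realType} {n : nat}.
Implicit Type A : cartanStarAlgebra R n.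

Lemma componentD {A} K (x y : A) : component K (x + y) = component K x + component K y.
Proof. exact: linearD. Qed.
Lemma componentB {A} K (x y : A) : component K (x - y) = component K x - component K y.
Proof. exact: linearB. Qed.
Lemma componentZ {A} K a (x : A) : component K (a *: x) = a * component K x.
Proof. exact: linearZ. Qed.
Lemma component0 {A} K : component K (0 : A) = 0.
Proof. exact: linear0. Qed.

Lemma component_e A (K L : {set 'I_n}) : component K (ca_e A L) = (L == K)%:R.
Proof.
rewrite /component -nth_subset_tuple coord_free; last exact: basis_free (ca_e_basis A).
by rewrite (inj_eq enum_rank_inj).
Qed.

Lemma component_sum {A} K (F : {set 'I_n} -> R) :
  component K (\sum_L F L *: ca_e A L) = F K.
Proof.
rewrite /component linear_sum (bigD1 K) //= linearZ /= -/(component K _) component_e.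
rewrite eqxx mulr1 big1 ?addr0 // => L LK.
by rewrite linearZ /= -/(component K _) component_e (negbTE LK) mulr0.
Qed.

Lemma componentE {A} (x : A) : x = \sum_K component K x *: ca_e A K.
Proof.
rewrite {1}(coord_basis (ca_e_basis A) (memvf x)).
rewrite (reindex (@enum_rank {set 'I_n})) /=; last first.
  exact/onW_bij/enum_rank_bij.
by apply: eq_bigr => K _; rewrite nth_subset_tuple.
Qed.

Lemma component_inj {A} (x y : A) : (forall K, component K x = component K y) -> x = y.
Proof.
by move=> xy; rewrite (componentE x) (componentE y); apply: eq_bigr => K _; rewrite xy.
Qed.

Lemma symdiff_symdiff_eq (L M K : {set 'I_n}) : (symdiff (symdiff L M) K == L) = (K == M).
Proof.
apply/eqP/eqP=> [/setP E|->]; apply/setP => i; last first.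
  by rewrite !inE; do 2!case: (_ \in _).
by move: (E i); rewrite !inE; do 3!case: (_ \in _).
Qed.

(** Multiplication by a basis vector permutes the basis up to sign, and e_M is the
    only basis vector that e_(L sd M) sends to a multiple of e_L (sd: symmetric
    difference). *)
Lemma component_mul_e {A} (L M : {set 'I_n}) (x : A) :
  component L (ca_mul (ca_e A (symdiff L M)) x) =
  ca_sigma A (symdiff L M) M * component M x.
Proof.
rewrite {1}(componentE x) ca_mulr_sum {1}/component linear_sum (bigD1 M) //=.
have E K : ca_mul (ca_e A (symdiff L M)) (component K x *: ca_e A K) =
    (component K x * ca_sigma A (symdiff L M) K) *:
      ca_e A (symdiff (symdiff L M) K).
  by rewrite ca_mulrZ ca_mul_e scalerA.
rewrite E linearZ /= -/(component L _) component_e symdiff_symdiff_eq eqxx mulr1 mulrC.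
rewrite big1 ?addr0 // => K KM.
by rewrite E linearZ /= -/(component L _) component_e symdiff_symdiff_eq (negbTE KM) mulr0.
Qed.

End Component.

(** * Circular sets and stem functions *)

Section StarCartan.
Context {R : realType} {n : nat} {A : cartanStarAlgebra R n}.
Implicit Types (J : A) (D : set (R * R)).
Local Notation "1A" := (ca_one A).

Lemma csa_conjD (x y : A) : csa_conj (x + y) = csa_conj x + csa_conj y.
Proof. by have := @csa_conj_linear _ _ A 1 x y; rewrite !scale1r. Qed.
Lemma csa_conj0 : csa_conj (0 : A) = 0.
Proof. by apply: (addIr (csa_conj 0)); rewrite -csa_conjD !add0r. Qed.
Lemma csa_conjZ a (x : A) : csa_conj (a *: x) = a *: csa_conj x.
Proof. by have := @csa_conj_linear _ _ A a x 0; rewrite !addr0 csa_conj0 addr0. Qed.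

Lemma imag_unitsN {J} : imag_units A J -> imag_units A (- J).
Proof.
rewrite -scaleN1r => -[Jc JJ]; split; first by rewrite csa_conjZ Jc scalerN.
by rewrite ca_mullZ ca_mulrZ JJ !scaleN1r !opprK.
Qed.

Lemma cartan_pair_imag_units (L M : {set 'I_n}) :
  cartan_pair A L M -> imag_units A (ca_e A (symdiff L M)).
Proof.
rewrite /cartan_pair ca_mul_e.
case: (ca_sigma_sign A L M) => ->; last by rewrite scale1r.
by move/imag_unitsN; rewrite scaleN1r opprK.
Qed.

(** The involution sends alpha + beta J to alpha - beta J: half the sum of the two
    recovers alpha, and the square of the remaining part beta J is - beta ^ 2. *)
Lemma slice_coords {a b a' b' : R} {J J'} : imag_units A J -> imag_units A J' ->
  a *: 1A + b *: J = a' *: 1A + b' *: J' -> a = a' /\ (b = b' \/ b = - b').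
Proof.
move=> [Jc JJ] [Jc' JJ'] E.
have Ec : a *: 1A - b *: J = a' *: 1A - b' *: J'.
  move/(congr1 (@csa_conj _ _ A)): E; rewrite !csa_conjD !csa_conj_real !csa_conjZ.
  by rewrite Jc Jc' !scalerN.
have aa' : a = a'.
  have : (2 * a) *: 1A = (2 * a') *: 1A.
    transitivity ((a *: 1A + b *: J) + (a *: 1A - b *: J)).
      by rewrite addrACA subrr addr0 -scalerDl mulrDl mul1r.
    by rewrite E Ec addrACA subrr addr0 -scalerDl [in RHS]mulrDl mul1r.
  move/(congr1 (component finset.set0)); rewrite !componentZ component_e eqxx !mulr1.
  by apply: mulfI; rewrite pnatr_eq0.
split=> //; move: E; rewrite aa' => /addrI E.
have : (b ^+ 2) *: 1A = (b' ^+ 2) *: 1A.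
  have : ca_mul (b *: J) (b *: J) = ca_mul (b' *: J') (b' *: J') by rewrite E.
  by rewrite !ca_mullZ !ca_mulrZ JJ JJ' !scalerN !scalerA => /oppr_inj.
move/(congr1 (component finset.set0)); rewrite !componentZ component_e eqxx !mulr1.
by move/eqP; rewrite eqf_sqr => /orP[]/eqP; tauto.
Qed.

Lemma circularization_subD {D D'} : (exists J, imag_units A J) ->
  stem_domain D' -> @circularization _ _ A D = @circularization _ _ A D' -> (D `<=` D')%classic.
Proof.
move=> [J SJ] [_ _ D'c] DD' [a b] Dab.
have : @circularization _ _ A D (a *: 1A + b *: J) by exists a, b, J.
rewrite DD' => -[a' [b' [J' [Dab' SJ' E]]]].
by have [-> [->|->]] := slice_coords SJ SJ' E; [|exact: D'c].
Qed.

Lemma circularization_inj {D D'} : (exists J, imag_units A J) ->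
  stem_domain D -> stem_domain D' ->
  @circularization _ _ A D = @circularization _ _ A D' -> D = D'.
Proof. by move=> SA ? ? E; apply/seteqP; split; exact: circularization_subD. Qed.

Lemma component_partial K v (G : R * R -> A) z :
  component K (partial v G z) = 'D_v (fun w => component K (G w)) z.
Proof. exact: component_sum. Qed.

Lemma holomorphic_stem_cauchy_riemann D (F : R * R -> A * A) K :
  holomorphic_stem D F ->
  cauchy_riemann D (fun z => component K (F z).1) (fun z => component K (F z).2).
Proof.
move=> [_ C1 C2 CR] z Dz; split.
- by move=> d dab; split; [case: (C1 K d z) | case: (C2 K d z)].
- have /(congr1 (component K \o fst)) /= := CR z Dz.
  rewrite component0 componentB !component_partial => /eqP.
  by rewrite subr_eq0 => /eqP.
have /(congr1 (component K \o snd)) /= := CR z Dz.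
rewrite component0 componentD !component_partial => /eqP.
by rewrite addr_eq0 => /eqP.
Qed.

(** The points alpha + beta J and alpha - beta J lie in the same slice, and the
    parities of the stem functions turn the two equalities given there into
    p + p' = q + q' and p - p' = q - q', which separate. *)
Lemma component_stem_eq {D} {F G : R * R -> A * A} {f g : A -> A} {L M : {set 'I_n}} :
  stem_domain D -> is_stem D F -> is_stem D G ->
  induced_on D F f -> induced_on D G g ->
  imag_units A (ca_e A (symdiff L M)) ->
  (forall x, @circularization _ _ A D x -> slice (ca_e A (symdiff L M)) x ->
     component L (f x) = component L (g x)) ->
  forall z, D z -> component L (F z).1 = component L (G z).1 /\
                   component M (F z).2 = component M (G z).2.
Proof.
move=> [_ _ Dc] Fs Gs Ff Gg; set J := ca_e A _ => SJ fg [a b] Dz.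
pose s := ca_sigma A (symdiff L M) M.
have E c d : D (c, d) ->
    component L (F (c, d)).1 + s * component M (F (c, d)).2 =
    component L (G (c, d)).1 + s * component M (G (c, d)).2.
  move=> Dcd; rewrite -!component_mul_e -!componentD -/J -(Ff c d J) // -(Gg c d J) //.
  by apply: fg; [exists c, d, J | exists c, d].
have := E _ _ (Dc _ _ Dz).
have [-> ->] := Fs _ _ Dz; have [-> ->] := Gs _ _ Dz.
have componentN (x : A) : component M (- x) = - component M x by exact: linearN.
rewrite !componentN !mulrN; have := E _ _ Dz.
set p := component L _; set q := component L _; set p' := s * _; set q' := s * _.
move=> e1 e2.
have pq : p = q.
  apply: (@mulfI _ 2); first by rewrite pnatr_eq0.
  have : (p + p') + (p - p') = (q + q') + (q - q') by rewrite e1 e2.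
  by rewrite addrACA subrr addr0 addrACA subrr addr0 !mulrDl !mul1r.
split=> //; move: e1; rewrite pq => /addrI /mulfI; apply.
exact: ca_sigma_neq0.
Qed.

End StarCartan.

Theorem corollary5p11 (R : realType) (n : nat) (n_gt0 : (0 < n)%N)
    (A : cartanStarAlgebra R n) (A_alt : alternative A)
    (SA_neq0 : exists J : A, imag_units A J)
    (Om : set A) (Om_csd : circular_slice_domain Om)
    (C : set (A * A)) (C_SCP : is_SCP C)
    (f g : A -> A) (f_reg : slice_regular Om f) (g_reg : slice_regular Om g)
    (fg : forall L M : {set 'I_n}, C (ca_e A L, ca_e A M) ->
       forall x : A, Om x -> slice (ca_e A (symdiff L M)) x ->
         component L (f x) = component L (g x)) :
  exists c : A, forall x : A, Om x -> f x - g x = c.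
Proof.
case: Om_csd => D [Dstem Dconn [a0 Da0] OmD].
case: f_reg => D1 [F [D1stem OmD1 Fhol Ff]].
case: g_reg => D2 [G [D2stem OmD2 Ghol Gg]].
have ? : D1 = D by apply: (circularization_inj SA_neq0) => //; rewrite -OmD1.
have ? : D2 = D by apply: (circularization_inj SA_neq0) => //; rewrite -OmD2.
subst D1 D2 => {OmD1 OmD2 D1stem D2stem}; have [_ Dopen _] := Dstem.
have [[Fs _ _ _] [Gs _ _ _]] := (Fhol, Ghol).
case: C_SCP => C_pair C_cover _.
have C_eq L M : C (ca_e A L, ca_e A M) -> forall z, D z ->
    component L (F z).1 = component L (G z).1 /\
    component M (F z).2 = component M (G z).2.
  move=> CLM; apply: (component_stem_eq Dstem Fs Gs Ff Gg).
    apply: cartan_pair_imag_units; have [L' [M' [[eL eM]]]] := C_pair _ CLM.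
    by rewrite /cartan_pair eL eM.
  by move=> x Dx; apply: fg; rewrite // OmD.
pose u K z := component K (F z).1 - component K (G z).1.
pose v K z := component K (F z).2 - component K (G z).2.
have uv K : cauchy_riemann D (u K) (v K).
  by apply: cauchy_riemannB; exact: holomorphic_stem_cauchy_riemann.
(* A stem function has odd second component, which vanishes on the real axis. *)
have v_real K : v K (a0, 0) = 0.
  have odd0 (H : R * R -> A * A) : is_stem D H -> component K (H (a0, 0)).2 = 0.
    move=> /(_ _ _ Da0)[_]; rewrite oppr0 => /(congr1 (component K))/eqP.
    have -> (x : A) : component K (- x) = - component K x by exact: linearN.
    by rewrite -addr_eq0 -mulr2n mulrn_eq0 => /eqP.
  by rewrite /v !odd0 // subrr.
have cst K : (forall z, D z -> u K z = u K (a0, 0)) /\ (forall z, D z -> v K z = 0).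
  have [[M CKM]|[L CLK]] : (pair_fst C `|` pair_snd C)%classic K by rewrite C_cover.
    have u0 z : D z -> u K z = 0 by move=> Dz; rewrite /u (C_eq _ _ CKM z Dz).1 subrr.
    split=> z Dz; first by rewrite !u0.
    by rewrite -(v_real K); exact: (cauchy_riemann_cst Dopen Dconn (uv K) u0).
  have v0 z : D z -> v K z = 0 by move=> Dz; rewrite /v (C_eq _ _ CLK z Dz).2 subrr.
  split=> // z Dz; apply: oppr_inj.
  exact: (cauchy_riemann_cst Dopen Dconn (cauchy_riemann_rot (uv K)) v0).
exists ((F (a0, 0)).1 - (G (a0, 0)).1) => x; rewrite OmD => -[a [b [J [Dz SJ ->]]]].
have FG2 : (F (a, b)).2 = (G (a, b)).2.
  by apply: component_inj => K; apply/eqP; rewrite -subr_eq0; apply/eqP/(cst K).2.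
rewrite (Ff _ _ _ Dz SJ) (Gg _ _ _ Dz SJ) FG2 opprD addrACA subrr addr0.
by apply: component_inj => K; rewrite !componentB; exact: (cst K).1.
Qed.
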